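(* The marked isomorphism problem is not semi-decidable for groups given by EDT0L presentations: there is no algorithm that, given as input two EDT0L presentations, halts if and only if the two marked groups they define are isomorphic as marked groups.
   Context: All alphabets are finite. An EDT0L language over an alphabet $A$ is one of the form $A^*\cap\bigcup_{n\ge 0}\Phi^n(w_0)$, where $A_E$ is a finite alphabet disjoint from $A$, $w_0\in (A\cup A_E)^*$, $\Phi$ is a finite set of monoid endomorphisms of $(A\cup A_E)^*$, and $\Phi^n(w_0)$ is the set of images of $w_0$ under all compositions of $n$ elements of $\Phi$. The finite data $(A,A_E,w_0,\Phi)$ is an EDT0L system describing the language. An EDT0L presentation $\langle S\mid R\rangle$ consists of a finite tuple $S$ of generating symbols and an EDT0L system describing a language $R\subseteq (S\cup S^{-1})^*$ over the alphabet $S\cup S^{-1}$; it defines the marked group $(\mathbb{F}_S/\langle\langle R\rangle\rangle,S)$, with $\mathbb{F}_S$ the free group on $S$ and $\langle\langle R\rangle\rangle$ the normal closure of $R$. A $k$-marked group is a group together with a generating $k$-tuple. Two $k$-marked groups $(G,(s_1,\dots,s_k))$ and $(H,(t_1,\dots,t_k))$ are isomorphic as marked groups if there is a group isomorphism $G\to H$ sending $s_i$ to $t_i$ for every $i$. *)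

(* Defs.v *)
From HB Require Import structures.
From mathcomp Require Import all_boot.
From mathcomp Require Import boolp classical_sets.

Set Implicit Arguments.
Unset Strict Implicit.
Unset Printing Implicit Defensive.

Local Open Scope classical_set_scope.

(* Letters of S ∪ S^-1: (s, false) stands for s and (s, true) for s^-1. *)
Definition letter (X : Type) : Type := (X * bool)%type.

Section FreeGroup.
Context {X : choiceType}.
Implicit Types (x y : letter X) (u v w : seq (letter X)).

Definition inv_letter x : letter X := (x.1, ~~ x.2).

Definition inv_word w : seq (letter X) := rev (map inv_letter w).

Definition reduced w : bool := sorted (fun x y => y != inv_letter x) w.

Definition push x w : seq (letter X) :=
  if w is y :: w' then if y == inv_letter x then w' else x :: w else [:: x].

Definition reduce w : seq (letter X) := foldr push [::] w.

Lemma inv_letterK : involutive inv_letter.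
Proof. by move=> [x b]; rewrite /inv_letter /= negbK. Qed.

Lemma push_reduced x w : reduced w -> reduced (push x w).
Proof.
case: w => [//|y w] /= yw; case: ifPn => [_|/= ->]; last exact: yw.
exact: path_sorted yw.
Qed.

Lemma foldr_push_reduced u w : reduced w -> reduced (foldr push w u).
Proof. by move=> rw; elim: u => //= x u; exact: push_reduced. Qed.

Lemma reduce_reduced w : reduced (reduce w).
Proof. exact: foldr_push_reduced. Qed.

Lemma reduced_reduce w : reduced w -> reduce w = w.
Proof.
elim: w => //= x [|y w] //= IH /andP[xy yw]; move: (IH yw) => /= ->.
by rewrite /= (negPf xy).
Qed.

Lemma pushK x w : reduced w -> push x (push (inv_letter x) w) = w.
Proof.
case: w => [|y w] /=; first by rewrite eqxx.
rewrite inv_letterK; case: eqP => [->|_ _] /=; last by rewrite eqxx.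
by case: w => //= z w /andP[/negPf ->].
Qed.

Lemma push_invK x w : reduced w -> push (inv_letter x) (push x w) = w.
Proof. by move=> rw; rewrite -{2}[x]inv_letterK pushK. Qed.

Lemma foldr_push_push x u w : reduced w ->
  foldr push w (push x u) = push x (foldr push w u).
Proof.
move=> rw; case: u => //= y u; case: eqP => //= ->.
by rewrite pushK// foldr_push_reduced.
Qed.

Lemma foldr_push_reduce u w : reduced w ->
  foldr push w (reduce u) = foldr push w u.
Proof. by move=> rw; elim: u => //= x u IH; rewrite foldr_push_push// IH. Qed.

Lemma reduce_catl u v : reduce (reduce u ++ v) = reduce (u ++ v).
Proof. by rewrite /reduce !foldr_cat foldr_push_reduce// reduce_reduced. Qed.

Lemma reduce_catr u v : reduce (u ++ reduce v) = reduce (u ++ v).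
Proof.
by rewrite /reduce !foldr_cat [foldr push [::] _](reduced_reduce (reduce_reduced v)).
Qed.

Lemma reduce_inv_word w : reduce (inv_word w ++ w) = [::].
Proof.
elim: w => //= x w IH; rewrite /inv_word /= rev_cons cat_rcons.
by rewrite /reduce foldr_cat /= push_invK ?foldr_push_reduced// -foldr_cat.
Qed.

End FreeGroup.

Record free_group (X : choiceType) : Type :=
  FreeGroup { fg_word : seq (letter X); _ : reduced fg_word }.

Section FreeGroupInstance.
Context {X : choiceType}.

HB.instance Definition _ := [isSub for @fg_word X].
HB.instance Definition _ := [Choice of free_group X by <:].

Definition fg_eval (w : seq (letter X)) : free_group X :=
  FreeGroup (reduce_reduced w).

Definition fg_one : free_group X := fg_eval [::].
Definition fg_mul (g h : free_group X) : free_group X :=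
  fg_eval (fg_word g ++ fg_word h).
Definition fg_inv (g : free_group X) : free_group X :=
  fg_eval (inv_word (fg_word g)).

Lemma fg_mulA : associative fg_mul.
Proof.
by move=> g h l; apply: val_inj; rewrite /= reduce_catl reduce_catr catA.
Qed.

Lemma fg_mul1 : left_id fg_one fg_mul.
Proof. by case=> w rw; apply: val_inj; rewrite /= reduced_reduce. Qed.

Lemma fg_mul1r : right_id fg_one fg_mul.
Proof. by case=> w rw; apply: val_inj; rewrite /= cats0 reduced_reduce. Qed.

Lemma fg_mulV : left_inverse fg_one fg_inv fg_mul.
Proof.
by case=> w rw; apply: val_inj; rewrite /= reduce_catl reduce_inv_word.
Qed.

Lemma fg_mulVr : right_inverse fg_one fg_inv fg_mul.
Proof.
have invK : involutive (@inv_word X).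
  by move=> w; rewrite /inv_word map_rev revK mapK//; exact: inv_letterK.
case=> w rw; apply: val_inj; rewrite /= reduce_catr -{1}[w]invK.
exact: reduce_inv_word.
Qed.

HB.instance Definition _ := isGroup.Build (free_group X)
  fg_mulA fg_mul1 fg_mul1r fg_mulV fg_mulVr.

Definition fg_gen (x : X) : free_group X := fg_eval [:: (x, false)].

End FreeGroupInstance.

Definition subgroup (G : groupType) (H : set G) : Prop :=
  [/\ H 1%g, forall x y, H x -> H y -> H (x * y)%g & forall x, H x -> H x^-1%g].

Definition generated_subgroup (G : groupType) (A : set G) : set G :=
  smallest (@subgroup G) A.

Definition normal_subgroup (G : groupType) (N : set G) : Prop :=
  subgroup N /\ forall x g, N x -> N (x ^ g)%g.

Record normalSubgroup (G : groupType) : Type := NormalSubgroup {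
  ns_set : set G;
  ns_normal : normal_subgroup ns_set }.

Definition normal_closure (G : groupType) (A : set G) : set G :=
  smallest (@normal_subgroup G) A.

Lemma normal_closure_normal (G : groupType) (A : set G) :
  normal_subgroup (normal_closure A).
Proof.
split; first split.
- by move=> N [[[]]].
- move=> x y Nx Ny N nN; have [[[_ + _] _] _] := nN; apply.
    exact: Nx nN.
  exact: Ny nN.
- by move=> x Nx N nN; have [[[_ _ +] _] _] := nN; apply; exact: Nx nN.
- by move=> x g Nx N nN; have [[_ +] _] := nN; apply; exact: Nx nN.
Qed.

Section Quotient.
Context {G : groupType} (N : normalSubgroup G).
Implicit Types x y z : G.

Definition coset_rel : rel G := fun x y => `[< ns_set N (x^-1 * y)%g >].

Let N1 : ns_set N 1%g.
Proof. by have [[]] := ns_normal N. Qed.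
Let NM x y : ns_set N x -> ns_set N y -> ns_set N (x * y)%g.
Proof. by have [[_ + _] _] := ns_normal N; apply. Qed.
Let NV x : ns_set N x -> ns_set N x^-1%g.
Proof. by have [[_ _ +] _] := ns_normal N; apply. Qed.
Let NJ x y : ns_set N x -> ns_set N (x ^ y)%g.
Proof. by have [_ +] := ns_normal N; apply. Qed.

Lemma coset_rel_refl : reflexive coset_rel.
Proof. by move=> x; apply/asboolP; rewrite mulVg. Qed.

Lemma coset_rel_sym : symmetric coset_rel.
Proof.
move=> x y; apply/asboolP/asboolP => /NV; rewrite invgM invgK; exact.
Qed.

Lemma coset_rel_trans : transitive coset_rel.
Proof.
move=> y x z /asboolP Nxy /asboolP Nyz; apply/asboolP.
by have := NM Nxy Nyz; rewrite mulgA mulgK.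
Qed.

Canonical coset_equiv :=
  EquivRel coset_rel coset_rel_refl coset_rel_sym coset_rel_trans.

Definition quotient_group : Type := {eq_quot coset_rel}%qT.
HB.instance Definition _ := Choice.on quotient_group.
HB.instance Definition _ := EqQuotient.on quotient_group.

Definition quotient_pi (x : G) : quotient_group := (\pi x)%qT.

Definition quotient_one : quotient_group := quotient_pi 1%g.
Definition quotient_mul (a b : quotient_group) : quotient_group :=
  quotient_pi (repr a * repr b)%g.
Definition quotient_inv (a : quotient_group) : quotient_group :=
  quotient_pi (repr a)^-1%g.

Lemma quotient_piP x y : quotient_pi x = quotient_pi y <-> ns_set N (x^-1 * y)%g.
Proof.
split=> [/eqmodP/asboolP //|Nxy].
by apply/eqmodP/asboolP.
Qed.

Lemma quotient_pi_repr a : quotient_pi (repr a) = a.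
Proof. exact: reprK. Qed.

Lemma quotient_piM x y :
  quotient_pi (x * y)%g = quotient_mul (quotient_pi x) (quotient_pi y).
Proof.
set x' := repr (quotient_pi x); set y' := repr (quotient_pi y).
have /quotient_piP Nx : quotient_pi x = quotient_pi x' by rewrite quotient_pi_repr.
have /quotient_piP Ny : quotient_pi y = quotient_pi y' by rewrite quotient_pi_repr.
apply/quotient_piP; have := NM (NJ y Nx) Ny.
by rewrite /conjg invgM !mulgA mulgK.
Qed.

Lemma quotient_piV x : quotient_pi x^-1%g = quotient_inv (quotient_pi x).
Proof.
set x' := repr (quotient_pi x).
have /quotient_piP Nx : quotient_pi x' = quotient_pi x by rewrite quotient_pi_repr.
apply/quotient_piP; have := NJ x'^-1%g Nx.
by rewrite /conjg !invgK !mulgA mulgV mul1g.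
Qed.

Lemma quotient_mulA : associative quotient_mul.
Proof.
move=> a b c; rewrite -[a]quotient_pi_repr -[b]quotient_pi_repr.
by rewrite -[c]quotient_pi_repr -!quotient_piM mulgA.
Qed.

Lemma quotient_mul1 : left_id quotient_one quotient_mul.
Proof. by move=> a; rewrite -[a]quotient_pi_repr -quotient_piM mul1g. Qed.

Lemma quotient_mul1r : right_id quotient_one quotient_mul.
Proof. by move=> a; rewrite -[a]quotient_pi_repr -quotient_piM mulg1. Qed.

Lemma quotient_mulV : left_inverse quotient_one quotient_inv quotient_mul.
Proof.
by move=> a; rewrite -[a]quotient_pi_repr -quotient_piV -quotient_piM mulVg.
Qed.

Lemma quotient_mulVr : right_inverse quotient_one quotient_inv quotient_mul.
Proof.
by move=> a; rewrite -[a]quotient_pi_repr -quotient_piV -quotient_piM mulgV.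
Qed.

HB.instance Definition _ := isGroup.Build quotient_group
  quotient_mulA quotient_mul1 quotient_mul1r quotient_mulV quotient_mulVr.

End Quotient.

Record markedGroup : Type := MarkedGroup {
  mg_rank : nat;
  mg_group : groupType;
  mg_gens : mg_rank.-tuple mg_group;
  mg_generated : generated_subgroup [set` mg_gens] = setT }.

(* The equality of sequences forces the two marked groups to have the same    *)
(* rank; marked groups of different ranks are not isomorphic.                 *)
Definition marked_iso (G H : markedGroup) : Prop :=
  exists f : {multiplicative mg_group G -> mg_group H},
    bijective f /\ map f (mg_gens G) = mg_gens H :> seq (mg_group H).

(* The extended alphabet is the disjoint union A + 'I_edt0l_ext. Each         *)
(* endomorphism is given by the images of all letters, those of A included.   *)
Record edt0l (A : finType) : Type := EDT0L {
  edt0l_ext : nat;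
  edt0l_axiom : seq (A + 'I_edt0l_ext);
  edt0l_endos : seq {ffun A + 'I_edt0l_ext -> seq (A + 'I_edt0l_ext)} }.

Definition endo_apply (B : finType) (phi : {ffun B -> seq B}) (w : seq B) :
  seq B := flatten [seq phi x | x <- w].

Definition endo_images (B : finType) (Phi : seq {ffun B -> seq B}) (n : nat)
    (w0 : seq B) : set (seq B) :=
  [set foldr (@endo_apply B) w0 phis |
    phis in [set phis : seq {ffun B -> seq B} |
      size phis = n /\ {subset phis <= Phi}]].

Definition edt0l_language (A : finType) (E : edt0l A) : set (seq A) :=
  [set w | (\bigcup_n endo_images (edt0l_endos E) n (edt0l_axiom E)) (map inl w)].

Record edt0l_presentation : Type := EDT0LPresentation {
  ep_rank : nat;
  ep_relators : edt0l (letter 'I_ep_rank) }.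

Section PresentedGroup.
Variable P : edt0l_presentation.

Definition ep_relations : set (free_group 'I_(ep_rank P)) :=
  [set fg_eval w | w in edt0l_language (ep_relators P)].

Definition ep_kernel : normalSubgroup (free_group 'I_(ep_rank P)) :=
  NormalSubgroup (normal_closure_normal ep_relations).

Definition ep_group : groupType := quotient_group ep_kernel.

Definition ep_gens : (ep_rank P).-tuple ep_group :=
  [tuple quotient_pi ep_kernel (fg_gen i) | i < ep_rank P].

Lemma ep_generated : generated_subgroup [set` ep_gens] = setT.
Proof.
apply/seteqP; split=> // a _ H [[H1 HM HV] Hgen].
have Hg i b : H (quotient_pi ep_kernel (fg_eval [:: (i, b)])).
  have Hi : H (quotient_pi ep_kernel (fg_gen i)).
    by apply: Hgen; apply/tnthP; exists i; rewrite tnth_mktuple.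
  case: b; last exact: Hi.
  by have := HV _ Hi; congr H; rewrite -[LHS](quotient_piV ep_kernel).
rewrite -[a]quotient_pi_repr; case: (repr a) => w rw.
have -> : FreeGroup rw = fg_eval w by apply: val_inj; rewrite /= reduced_reduce.
elim: w {rw} => [|[i b] w IH]; first exact: H1.
have := HM _ _ (Hg i b) IH; congr H; rewrite -[LHS](quotient_piM ep_kernel); congr quotient_pi.
by apply: val_inj; rewrite /= [LHS](reduce_catr [:: (i, b)] w).
Qed.

Definition ep_marked_group : markedGroup := MarkedGroup ep_generated.

End PresentedGroup.

(* Presentations are given to machines as binary words: a sequence of natural *)
(* numbers is written in unary with separators, and pair_code_inj shows that  *)
(* nothing is lost.                                                           *)
Definition nat_code (n : nat) : seq bool := rcons (nseq n true) false.

Section Codes.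
Variables k e : nat.
Local Notation symbol := (letter 'I_k + 'I_e)%type.

(* The letters of (S ∪ S^-1) ∪ A_E are numbered from 1, so that 0 can serve   *)
(* as an end-of-word marker.                                                  *)
Definition symbol_code (x : symbol) : nat :=
  match x with
  | inl (i, b) => (i.*2 + b).+1
  | inr j => (k.*2 + j).+1
  end.

Definition word_code (w : seq symbol) : seq nat := rcons (map symbol_code w) 0.

Definition endo_code (phi : {ffun symbol -> seq symbol}) : seq nat :=
  flatten [seq word_code (phi x) | x <- enum {: symbol}].

End Codes.

Definition presentation_nats (P : edt0l_presentation) : seq nat :=
  let E := ep_relators P in
  [:: ep_rank P; edt0l_ext E; size (edt0l_endos E)]
    ++ word_code (edt0l_axiom E)
    ++ flatten [seq endo_code phi | phi <- edt0l_endos E].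

Definition presentation_code (P : edt0l_presentation) : seq bool :=
  flatten [seq nat_code n | n <- presentation_nats P].

Definition pair_code (PQ : edt0l_presentation * edt0l_presentation) : seq bool :=
  presentation_code PQ.1 ++ presentation_code PQ.2.

Lemma nat_code_cat_inj m n s t :
  nat_code m ++ s = nat_code n ++ t -> m = n /\ s = t.
Proof.
elim: m n => [|m IH] [|n] //= [] //.
by move=> /IH[-> ->].
Qed.

Lemma symbol_code_inj k e : injective (@symbol_code k e).
Proof.
have dbl (i j : nat) (b c : bool) : i.*2 + b = j.*2 + c -> i = j /\ b = c.
  move=> h; have /(congr1 odd) := h; rewrite !oddD !odd_double !oddb /= => bc.
  by split=> //; apply/double_inj/(@addIn b); rewrite h bc.
have lt (i : 'I_k) (b : bool) : i.*2 + b < k.*2.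
  apply: leq_trans (_ : i.+1.*2 <= _); last by rewrite leq_double.
  by rewrite doubleS; case: b; rewrite ?addn1 ?addn0.
case=> [[i b]|j] [[i' b']|j'] /= [] h.
- by have [/ord_inj -> ->] := dbl _ _ _ _ h.
- by have := lt i b; rewrite h ltnNge leq_addr.
- by have := lt i' b'; rewrite -h ltnNge leq_addr.
- by congr inr; apply/ord_inj/(@addnI k.*2).
Qed.

Lemma word_code_cat_inj k e (u v : seq (letter 'I_k + 'I_e)) s t :
  word_code u ++ s = word_code v ++ t -> u = v /\ s = t.
Proof.
have code0 x : @symbol_code k e x <> 0 by case: x => [[]|].
elim: u v => [|x u IH] [|y v] /= [].
- by [].
- by move=> /esym/code0.
- by move=> /code0.
- by move=> /symbol_code_inj -> /IH[-> ->].
Qed.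

Lemma endo_code_cat_inj k e
    (phi psi : {ffun letter 'I_k + 'I_e -> seq (letter 'I_k + 'I_e)}) s t :
  endo_code phi ++ s = endo_code psi ++ t -> phi = psi /\ s = t.
Proof.
move=> h; suff [ext ->] : {in enum {: letter 'I_k + 'I_e}, phi =1 psi} /\ s = t.
  by split=> //; apply/ffunP => x; apply: ext; rewrite mem_enum.
move: h; rewrite /endo_code; elim: (enum _) => [|x xs IH] //=.
rewrite -!catA => /word_code_cat_inj[eqx] /IH[eqxs ->]; split=> // y.
by rewrite inE => /orP[/eqP ->|/eqxs].
Qed.

Lemma presentation_nats_cat_inj P Q s t :
  presentation_nats P ++ s = presentation_nats Q ++ t -> P = Q /\ s = t.
Proof.
case: P Q => [k [e w Phi]] [k' [e' w' Phi']]; rewrite /presentation_nats /=.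
case=> ek ee; move: w' Phi'; rewrite -{}ee; move: w Phi; rewrite -{}ek.
move=> w Phi w' Phi' eqsz; rewrite -!catA => /word_code_cat_inj[->].
suff H : forall s t, flatten [seq endo_code i | i <- Phi] ++ s =
    flatten [seq endo_code i | i <- Phi'] ++ t -> Phi = Phi' /\ s = t.
  by move=> /H[-> ->].
elim: Phi Phi' eqsz => [|f Phi IH] [|g Phi'] //= [eqsz] s' t'.
by rewrite -!catA => /endo_code_cat_inj[->] /(IH _ eqsz)[-> ->].
Qed.

Lemma pair_code_inj : injective pair_code.
Proof.
have inj (m n : seq nat) : flatten (map nat_code m) = flatten (map nat_code n) ->
    m = n.
  elim: m n => [|x m IH] [|y n] //=; [by case: y | by case: x |].
  by move=> /nat_code_cat_inj[-> /IH ->].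
move=> [P P'] [Q Q']; rewrite /pair_code /presentation_code [in X in X -> _]/fst [in X in X -> _]/snd.
rewrite -!flatten_cat -!map_cat => /inj /presentation_nats_cat_inj[->].
by rewrite -[presentation_nats P']cats0 -[presentation_nats Q']cats0
  => /presentation_nats_cat_inj[->].
Qed.

Inductive direction : Type := Leftward | Rightward | Stay.

(* Deterministic machines with one two-way infinite tape. A tape cell is      *)
(* None (blank), Some (inl b) (an input symbol) or Some (inr x) (an auxiliary *)
(* tape symbol); the machine halts where the transition function is None.     *)
Record turing_machine : Type := TuringMachine {
  tm_state : finType;
  tm_aux : finType;
  tm_start : tm_state;
  tm_trans : tm_state -> option (bool + tm_aux) ->
             option (tm_state * option (bool + tm_aux) * direction) }.

Section Run.
Variable M : turing_machine.
Local Notation cell := (option (bool + tm_aux M)).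

(* The cells left of the head are listed from the head outwards, and so are   *)
(* those right of it; all cells beyond the two lists are blank.               *)
Record config : Type := Config {
  cf_state : tm_state M;
  cf_left : seq cell;
  cf_head : cell;
  cf_right : seq cell }.

Definition tm_init (w : seq bool) : config :=
  let t := [seq Some (inl b) : cell | b <- w] in
  Config (tm_start M) [::] (head None t) (behead t).

Definition tm_step (c : config) : option config :=
  let: Config q l x r := c in
  if tm_trans q x is Some (q', y, d) then
    Some (match d with
          | Leftward => Config q' (behead l) (head None l) (y :: r)
          | Rightward => Config q' (y :: l) (head None r) (behead r)
          | Stay => Config q' l y r
          end)
  else None.

Definition tm_halts (w : seq bool) : Prop :=
  exists n, iter n (obind tm_step) (Some (tm_init w)) = None.

End Run.

Definition semi_decidable (T : Type) (code : T -> seq bool) (D : T -> Prop) :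
    Prop :=
  exists M : turing_machine, forall x, tm_halts M (code x) <-> D x.

(* Main.v *)
(* Fix a machine M supposed to semi-decide the problem. The words considered  *)
(* as relators are the commutators [a, b^v] with v in a language L over an    *)
(* alphabet D. In the free group on D, a, b none of them is a consequence of  *)
(* the others: given x0, let D act on free_group D * option bool by           *)
(* translations, and a, b by noncommuting involutions of the second factor,   *)
(* over the points x0 and 1 only; then [a, b^v] acts trivially exactly when   *)
(* v <> x0. Hence for L1 included in L2 the marked groups are isomorphic iff  *)
(* L1 = L2.                                                                   *)
(*                                                                            *)
(* A run of M is simulated by a deterministic queue automaton: a word w can   *)
(* be consumed from the initial queue q iff w is a prefix of q ++ outputs w.  *)
(* Let S be the language of the words w | g where w and g differ at some      *)
(* position, and T that of the words w | q ++ outputs w where reading w       *)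
(* halts the automaton. Both are EDT0L, S regardless of the machine, and T is *)
(* included in S iff M does not halt on the input encoded by q.               *)
(*                                                                            *)
(* Finally q can be the encoding of the pair of presentations for S and       *)
(* S union T itself: the table of T that contains a data word is used several *)
(* times, and the data word is read in turn as literal bits and as quotation. *)
(* So M halts on that pair iff it does not.                                   *)

From HB Require Import structures.
Require Import Defs.
From mathcomp Require Import all_boot.
From mathcomp Require Import boolp classical_sets zify.

Set Implicit Arguments.
Unset Strict Implicit.
Unset Printing Implicit Defensive.

(** * Commutator relators and their independence *)

(** The proof is a diagonal argument: every machine [M] admits a pair of presentations whose marked
    groups are isomorphic exactly when [M] diverges on the code of that pair
    ([marked_iso_iff_diverges]). The group theory enters through [relator_of_independent]: distinct
    words give independent relators, so for nested sets of tables [system_marked_iso] turns marked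
    isomorphism into equality of languages of words. The larger language adds to the mismatches the
    words [w | q ++ outputs w] in which [w] drives the automaton to its halted control. Such a word
    escapes the mismatches only if [w] is a genuine history read from the queue [q], and by
    [simulation_halts] such a [w] exists iff [M] halts on the input behind [q]. That input can be
    the pair itself, by a quine ([self_referential_pair]): the presentations write [q] from a data
    word that one of them contains. *)

Section Signed.
Variables X B : Type.
Implicit Types (em : bool -> X -> B) (c : bool -> bool -> B) (w : seq X).

Definition signed em (s : bool) w : seq B :=
  if s then rev (map (em true) w) else map (em false) w.

(* The commutator [a, b^w], where c false s and c true s are the letters for  *)
(* a and b, inverted if s.                                                    *)
Definition comm_relator em c w : seq B :=
  [:: c false true] ++ signed em true w ++ [:: c true true] ++ signed em false w
  ++ [:: c false false] ++ signed em true w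
  ++ [:: c true false] ++ signed em false w.

End Signed.
Arguments signed : simpl never.

Lemma signed_map (X Y B C : Type) (f : X -> Y) (g : B -> C) em em' s w :
  (forall t x, em' t (f x) = g (em t x)) ->
  signed em' s (map f w) = map g (signed em s w).
Proof.
move=> emE; rewrite /signed; case: s; rewrite -?map_comp ?map_rev -?map_comp.
  by congr rev; apply: eq_map => x /=.
by apply: eq_map => x /=.
Qed.

Lemma comm_relator_map (X Y B C : Type) (f : X -> Y) (g : B -> C) em em' c c' w :
  (forall t x, em' t (f x) = g (em t x)) -> (forall t u, c' t u = g (c t u)) ->
  comm_relator em' c' (map f w) = map g (comm_relator em c w).
Proof.
move=> emE cE; rewrite /comm_relator !map_cat /= !cE.
by rewrite !(signed_map _ _ emE).
Qed.

Section CommutatorRelators.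
Variable D : finType.
Local Notation k := #|{: option (option D)}|.

Definition word_letter (s : bool) (d : D) : letter 'I_k :=
  (enum_rank (Some (Some d)), s).

Definition comm_letter (t s : bool) : letter 'I_k :=
  (enum_rank (if t then Some None else None), s).

Definition relator_of : seq D -> seq (letter 'I_k) :=
  comm_relator word_letter comm_letter.

Section WreathAction.
Variable x0 : seq D.
Local Notation point := (free_group D * option bool)%type.

Definition positive (v : seq D) : free_group D := fg_eval (map (pair^~ false) v).

Lemma positive_cons d v : positive (d :: v) = (fg_gen d * positive v)%g.
Proof. by apply: val_inj; exact/esym/(reduce_catr [:: (d, false)]). Qed.

(** Positive words contain no cancelling pair, so they are their own normal forms. *)
Lemma positive_inj : injective positive.
Proof.
have red v : reduced (map (pair^~ false) v : seq (letter D)).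
  by case: v => //= d v; elim: v d => //= d' v IH d; rewrite IH xpair_eqE andbF.
move=> u v /(congr1 val) /=; rewrite !reduced_reduce //.
by apply: inj_map => d d' [].
Qed.

Definition swap1 (i : option bool) : option bool := omap negb i.
Definition swap2 (i : option bool) : option bool :=
  match i with None => Some true | Some true => None | Some false => Some false end.

Lemma swap1K : involutive swap1. Proof. by move=> [[]|]. Qed.
Lemma swap2K : involutive swap2. Proof. by move=> [[]|]. Qed.

Definition act_letter (l : letter 'I_k) (y : point) : point :=
  match enum_val l.1 with
  | None => (y.1, if y.1 == positive x0 then swap1 y.2 else y.2)
  | Some None => (y.1, if y.1 == 1%g then swap2 y.2 else y.2)
  | Some (Some d) => ((y.1 * (if l.2 then (fg_gen d)^-1 else fg_gen d))%g, y.2)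
  end.

Definition act (w : seq (letter 'I_k)) (y : point) : point :=
  foldl (fun y l => act_letter l y) y w.

Lemma act_cat u v y : act (u ++ v) y = act v (act u y).
Proof. exact: foldl_cat. Qed.

Lemma act_letterK l : cancel (act_letter l) (act_letter (inv_letter l)).
Proof.
case: l => j s [g i]; rewrite /act_letter /=.
case: (enum_val j) => [[d|]|] /=.
- by case: s; rewrite /= ?mulgVK ?mulgK.
- by case: eqP => // _; rewrite swap2K.
- by case: eqP => // _; rewrite swap1K.
Qed.

Lemma act_reduce w y : act (reduce w) y = act w y.
Proof.
elim: w y => //= l w IH y; rewrite -IH.
case: (reduce w) => //= l' w'; case: eqP => //= ->.
by rewrite act_letterK.
Qed.

Lemma act_inv_word w y : act (inv_word w) (act w y) = y.
Proof.
elim: w y => //= l w IH y; rewrite /inv_word /= rev_cons -cats1 act_cat.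
by rewrite IH /= act_letterK.
Qed.

Definition act_kernel : set (free_group 'I_k) :=
  [set g | forall y, act (fg_word g) y = y].

Lemma act_kernel_normal : normal_subgroup act_kernel.
Proof.
have actV g y : act (fg_word g^-1%g) (act (fg_word g) y) = y.
  by rewrite /= act_reduce act_inv_word.
have actM g h y : act (fg_word (g * h)%g) y = act (fg_word h) (act (fg_word g) y).
  by rewrite /= act_reduce act_cat.
split; first split.
- by [].
- by move=> g h gK hK y; rewrite actM gK hK.
- by move=> g gK y; rewrite -{1}[y]gK actV.
- move=> g h gK y; rewrite /conjg !actM gK.
  by rewrite -{1}[h]invgK actV.
Qed.

Lemma act_word v y : act (signed word_letter false v) y = ((y.1 * positive v)%g, y.2).
Proof.
elim: v y => [|d v IH] [g i]; first by rewrite /positive mulg1.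
rewrite /signed /= in IH *; rewrite IH.
by rewrite /act_letter /= enum_rankK /= positive_cons mulgA.
Qed.

Lemma act_wordV v y :
  act (signed word_letter true v) y = ((y.1 * (positive v)^-1)%g, y.2).
Proof.
have -> : signed word_letter true v = inv_word (signed word_letter false v).
  by rewrite /signed /inv_word -map_comp.
case: y => g i /=; have := act_inv_word (signed word_letter false v)
  ((g * (positive v)^-1)%g, i).
by rewrite act_word /= mulgVK.
Qed.

(** Conjugation by [v] moves the support of [b] from the fibre over 1 to the fibre over
    [positive v]. Signs of [a] and [b] disappear because both act by involutions. *)
Lemma act_relator v g i :
  act (relator_of v) (g, i) =
  let a j := if g == positive x0 then swap1 j else j in
  let b j := if g == positive v then swap2 j else j in
  (g, b (a (b (a i)))).
Proof.
have act_a s y : act [:: comm_letter false s] y =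
    (y.1, if y.1 == positive x0 then swap1 y.2 else y.2).
  by rewrite /= /act_letter /= enum_rankK.
have act_b s y : act [:: comm_letter true s] y =
    (y.1, if y.1 == 1%g then swap2 y.2 else y.2).
  by rewrite /= /act_letter /= enum_rankK.
rewrite /relator_of /comm_relator !act_cat !(act_word, act_wordV, act_a, act_b) /=.
by rewrite !mulgVK !divg_eq1.
Qed.

Lemma relator_of_independent (L : set (seq D)) :
  normal_closure [set fg_eval (relator_of v) | v in L] (fg_eval (relator_of x0)) ->
  L x0.
Proof.
move=> clo; apply: contrapT => Lx0.
have /(_ (positive x0, None)) : act_kernel (fg_eval (relator_of x0)).
  apply: clo; split; first exact: act_kernel_normal.
  move=> _ [v Lv <-] [g i]; rewrite [LHS]act_reduce act_relator /=.
  case: eqP => [-> |_].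
    case: eqP => [/positive_inj vx|_]; last by rewrite swap2K.
    by case: Lx0; rewrite -vx.
  by case: eqP => // _; rewrite swap1K.
(* Over [positive x0] both involutions are active, and the relator sends [None] to [Some false]. *)
by rewrite [X in X = _]act_reduce act_relator !eqxx.
Qed.

End WreathAction.
End CommutatorRelators.

(** * Marked isomorphisms and kernels *)

Section MarkedIso.
Variables (k : nat) (E1 E2 : edt0l (letter 'I_k)).
Let P1 := EDT0LPresentation E1.
Let P2 := EDT0LPresentation E2.

Lemma eq_marked_iso :
  edt0l_language E1 = edt0l_language E2 ->
  marked_iso (ep_marked_group P1) (ep_marked_group P2).
Proof.
move=> eqL; have eqN : ep_kernel P1 = ep_kernel P2.
  have eqS : ns_set (ep_kernel P1) = ns_set (ep_kernel P2).
    by rewrite /= /ep_relations /= eqL.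
  move: eqS; case: (ep_kernel P1) => N1 n1; case: (ep_kernel P2) => N2 n2 /= eqS.
  by subst N2; congr NormalSubgroup; exact: Prop_irrelevance.
(* With [N1] and [N2] general, the equality can be eliminated, after which the two quotients are the
   same type and the identity serves. *)
have gen (N1 N2 : normalSubgroup (free_group 'I_k)) : N1 = N2 ->
    exists f : {multiplicative quotient_group N1 -> quotient_group N2},
      bijective f /\
      map f [tuple quotient_pi N1 (fg_gen i) | i < k] =
      [tuple quotient_pi N2 (fg_gen i) | i < k] :> seq _.
  move=> <-; exists idfun; split; first by exists idfun.
  by rewrite map_id.
exact: (gen _ _ eqN).
Qed.

(** Agreeing on generators, the isomorphism sends the class of each word to the class of the same
    word; injectivity then pulls triviality back. *)
Lemma marked_iso_kernel :
  marked_iso (ep_marked_group P1) (ep_marked_group P2) ->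
  forall w, ns_set (ep_kernel P2) (fg_eval w) -> ns_set (ep_kernel P1) (fg_eval w).
Proof.
move=> [f [bij_f f_gens]] w.
pose pi1 := quotient_pi (ep_kernel P1); pose pi2 := quotient_pi (ep_kernel P2).
have f_gen i : f (pi1 (fg_gen i)) = pi2 (fg_gen i).
  have := congr1 (fun s => nth 1%g s i) f_gens.
  by rewrite (nth_map 1%g) ?size_tuple // -!tnth_nth !tnth_mktuple.
have f1 : f 1%g = 1%g by apply: (mulgI (f 1%g)); rewrite -gmulfM !mulg1.
have fV x : f x^-1%g = (f x)^-1%g.
  by apply: (mulgI (f x)); rewrite -gmulfM !mulgV.
have fw : f (pi1 (fg_eval w)) = pi2 (fg_eval w).
  elim: w => [|[i s] w IH]; first exact: f1.
  have -> : fg_eval ((i, s) :: w) = (fg_eval [:: (i, s)] * fg_eval w)%g.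
    by apply: val_inj; exact/esym/(reduce_catr [:: (i, s)]).
  rewrite /pi1 /pi2 [X in f X](quotient_piM (ep_kernel P1)).
  rewrite [RHS](quotient_piM (ep_kernel P2)) [LHS]gmulfM IH; congr (_ * _)%g.
  case: s; last exact: f_gen.
  have -> : fg_eval [:: (i, true)] = (fg_gen i)^-1%g by exact: val_inj.
  rewrite [X in f X](quotient_piV (ep_kernel P1)) [RHS](quotient_piV (ep_kernel P2)).
  by rewrite [LHS]fV; congr (_^-1)%g; exact: f_gen.
have kerE (P : edt0l_presentation) (g : free_group 'I_(ep_rank P)) :
    ns_set (ep_kernel P) g <-> quotient_pi (ep_kernel P) g = 1%g.
  split=> [Ng|/esym/quotient_piP]; last by rewrite invg1 mul1g.
  by apply/esym/quotient_piP; rewrite invg1 mul1g.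
move=> /(kerE P2) w2; apply/(kerE P1); apply: (bij_inj bij_f).
by rewrite f1 -w2; exact: fw.
Qed.

End MarkedIso.

(** * EDT0L systems for commutator relators *)

Section SubstitutionSystems.
Variables D N : finType.
Local Notation k := #|{: option (option D)}|.
Local Notation e := #|{: letter N}|.
Local Notation table := {ffun N -> seq (D + N)}.
Implicit Types (f : table) (F : seq table) (w : seq (D + N)).

Definition subst f w : seq (D + N) :=
  flatten [seq if z is inr n then f n else [:: z] | z <- w].

Lemma subst_cat f u v : subst f (u ++ v) = subst f u ++ subst f v.
Proof. by rewrite /subst map_cat flatten_cat. Qed.

Lemma subst_terminal f v : subst f (map inl v) = map inl v.
Proof. by rewrite /subst; elim: v => //= d v ->. Qed.

Lemma subst1 f n : subst f [:: inr n] = f n.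
Proof. by rewrite /subst /= cats0. Qed.

Inductive derives F w0 : seq (D + N) -> Prop :=
| derives_refl : derives F w0 w0
| derives_subst f w : f \in F -> derives F w0 w -> derives F w0 (subst f w).

Lemma derives_foldr F w0 w :
  derives F w0 w <-> exists2 fs, {subset fs <= F} & w = foldr subst w0 fs.
Proof.
split=> [|[fs + ->]].
  elim=> [|f {}w fF _ [fs fsF ->]]; first by exists [::].
  by exists (f :: fs) => // g; rewrite inE => /predU1P[->|/fsF].
elim: fs => [|f fs IH] fsF; first exact: derives_refl.
apply: derives_subst; first by apply: fsF; rewrite mem_head.
by apply: IH => g gfs; apply: fsF; rewrite inE gfs orbT.
Qed.

Lemma derives_trans F u v w : derives F u v -> derives F v w -> derives F u w.
Proof. by move=> uv; elim=> // f w' fF _; exact: derives_subst. Qed.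

Lemma derives1 F f w0 : f \in F -> derives F w0 (subst f w0).
Proof. by move=> fF; apply: derives_subst fF (derives_refl _ _). Qed.

Lemma derives_subset F F' w0 w :
  {subset F <= F'} -> derives F w0 w -> derives F' w0 w.
Proof. by move=> sFF'; elim=> [|f w' /sFF' fF' _]; [left|exact: derives_subst]. Qed.

(* Every nonterminal gets a formal inverse, so that w and its inverse can be  *)
(* rewritten in parallel inside the relator.                                  *)
Definition symbol_letter (s : bool) (z : D + N) : letter 'I_k + 'I_e :=
  match z with
  | inl d => inl (word_letter s d)
  | inr n => inr (enum_rank (n, s))
  end.

Definition endo f : {ffun letter 'I_k + 'I_e -> seq (letter 'I_k + 'I_e)} :=
  [ffun y => if y is inr j then
      signed symbol_letter (enum_val j).2 (f (enum_val j).1)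
    else [:: y]].

Definition relator_form w : seq (letter 'I_k + 'I_e) :=
  comm_relator symbol_letter (fun t s => inl (comm_letter D t s)) w.

Definition system F (n0 : N) : edt0l (letter 'I_k) :=
  EDT0L (relator_form [:: inr n0]) (map endo F).

Lemma endo_apply_cat (B : finType) (phi : {ffun B -> seq B}) u v :
  endo_apply phi (u ++ v) = endo_apply phi u ++ endo_apply phi v.
Proof. by rewrite /endo_apply map_cat flatten_cat. Qed.

(** The image of an inverted nonterminal is the formal inverse of its image, so [endo f] commutes
    with formal inversion. Hence the four copies of [w] in a relator evolve in parallel. *)
Lemma endo_apply_signed f s w :
  endo_apply (endo f) (signed symbol_letter s w) =
  signed symbol_letter s (subst f w).
Proof.
have signed_cat t u v : signed symbol_letter t (u ++ v) =
    if t then signed symbol_letter t v ++ signed symbol_letter t u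
    else signed symbol_letter t u ++ signed symbol_letter t v.
  by rewrite /signed; case: t; rewrite !map_cat ?rev_cat.
have apply1 z : endo_apply (endo f) (signed symbol_letter s [:: z]) =
    signed symbol_letter s (if z is inr n then f n else [:: z]).
  rewrite /signed /endo_apply; case: z => [d|n].
    by case: s; rewrite /= /endo ffunE.
  by case: s; rewrite /= /endo ffunE enum_rankK cats0.
elim: w => [|z w IH]; first by case: s {apply1}.
have -> : subst f (z :: w) = (if z is inr n then f n else [:: z]) ++ subst f w by [].
rewrite -(cat1s z w) !signed_cat.
by rewrite (fun_if (endo_apply (endo f))) !endo_apply_cat IH apply1.
Qed.

Lemma endo_apply_relator f w :
  endo_apply (endo f) (relator_form w) = relator_form (subst f w).
Proof.
have comm_fix t s : endo_apply (endo f) [:: inl (comm_letter D t s)] =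
    [:: inl (comm_letter D t s)].
  by rewrite /endo_apply /= /endo ffunE.
by rewrite /relator_form /comm_relator !endo_apply_cat !comm_fix !endo_apply_signed.
Qed.

Lemma relator_form_terminal v :
  relator_form (map inl v) = map inl (relator_of v).
Proof. exact: comm_relator_map. Qed.

Lemma relator_form_terminalE w u :
  relator_form w = map inl u -> exists2 v, w = map inl v & u = relator_of v.
Proof.
move=> wu; suff [v wv] : exists v, w = map inl v.
  exists v => //; apply: (@inj_map _ _ (@inl _ 'I_e)); first by move=> ? ? [].
  by rewrite -wu wv relator_form_terminal.
have : all (fun y : letter 'I_k + 'I_e => if y is inl _ then true else false)
    (signed symbol_letter false w).
  have : all (fun y : letter 'I_k + 'I_e => if y is inl _ then true else false)
    (relator_form w) by rewrite wu; elim: u {wu}.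
  by rewrite /relator_form /comm_relator !all_cat; case/andP=> _ /andP[_ /andP[_ /andP[]]].
rewrite /signed; elim: w {wu} => [|[d|n] w IH] //=; first by exists [::].
by move=> /IH[v ->]; exists (d :: v).
Qed.

Lemma system_language F n0 :
  edt0l_language (system F n0) =
  [set relator_of v | v in [set v | derives F [:: inr n0] (map inl v)]]%classic.
Proof.
have foldr_endo fs : foldr (@endo_apply _) (relator_form [:: inr n0]) (map endo fs) =
    relator_form (foldr subst [:: inr n0] fs).
  by elim: fs => //= f fs ->; rewrite endo_apply_relator.
apply/seteqP; split=> u.
  move=> [n _ [phis [_ phisF]]] /= eq_u.
  have [fs fsF eq_phis] : exists2 fs, {subset fs <= F} & phis = map endo fs.
    elim: phis phisF {eq_u} => [|phi phis IH] phisF; first by exists [::].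
    have /mapP[f fF ->] := phisF phi (mem_head _ _).
    have [|fs fsF ->] := IH.
      by move=> psi psis; apply: phisF; rewrite inE psis orbT.
    by exists (f :: fs) => // g; rewrite inE => /predU1P[->|/fsF].
  move: eq_u; rewrite eq_phis foldr_endo => /relator_form_terminalE[v eq_v ->].
  by exists v => //=; apply/derives_foldr; exists fs.
move=> [v /derives_foldr[fs fsF eq_v] <-]; exists (size (map endo fs)) => //.
exists (map endo fs).
  by split=> // _ /mapP[f /fsF fF ->]; exact: map_f.
by rewrite foldr_endo -eq_v relator_form_terminal.
Qed.

End SubstitutionSystems.

Section SystemIso.
Variables (D N : finType) (F1 F2 : seq {ffun N -> seq (D + N)}) (n0 : N).

Definition presentation_of (F : seq {ffun N -> seq (D + N)}) :=
  EDT0LPresentation (system F n0).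

(** An isomorphism makes every relator of the larger system a consequence of those of the smaller
    one; independence then puts its word in the smaller language. *)
Lemma system_marked_iso : {subset F1 <= F2} ->
  marked_iso (ep_marked_group (presentation_of F1))
             (ep_marked_group (presentation_of F2)) <->
  (forall v, derives F2 [:: inr n0] (map inl v) ->
             derives F1 [:: inr n0] (map inl v)).
Proof.
move=> sF12; split=> [iso v F2v|F21].
  suff : [set v | derives F1 [:: inr n0] (map inl v)]%classic v by [].
  apply: relator_of_independent.
  have := marked_iso_kernel iso (w := relator_of v).
  rewrite /= /ep_relations /= !system_language => /(_ _) ker12.
  have {ker12} : normal_closure [set fg_eval w | w in
      [set relator_of v | v in [set v | derives F1 [:: inr n0] (map inl v)]]]%classic
      (fg_eval (relator_of v)).
    by apply: ker12 => L [_ genL]; apply: genL; exists (relator_of v) => //; exists v.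
  by rewrite image_comp.
apply: eq_marked_iso; rewrite !system_language; congr image.
by apply/seteqP; split=> v /=; [exact: derives_subset|exact: F21].
Qed.

End SystemIso.

(** * Queue automata and Turing machines *)

Section QueueAutomaton.
Variables X Z : eqType.
Variables (step : Z -> X -> Z) (out : Z -> X -> seq X).
Implicit Types (z : Z) (w u v : seq X).

Definition run z w : Z := foldl step z w.

Fixpoint outputs z w : seq X :=
  if w is x :: w' then out z x ++ outputs (step z x) w' else [::].

Lemma run_cat z u v : run z (u ++ v) = run (run z u) v.
Proof. exact: foldl_cat. Qed.

Lemma outputs_cat z u v : outputs z (u ++ v) = outputs z u ++ outputs (run z u) v.
Proof. by elim: u z => //= x u IH z; rewrite IH catA. Qed.

(* With q as initial queue, the symbols read are exactly w: the automaton     *)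
(* reads from the front of the queue the initial symbols, then its outputs.   *)
Definition consumable q z w : bool := prefix w (q ++ outputs z w).

(** By [growth], the symbol at position [n] is already in the queue once the first [n] symbols are
    read, so it is determined by them. *)
Lemma consumable_comparable q z u v :
  (forall w, size w < size (q ++ outputs z w)) ->
  consumable q z u -> consumable q z v -> size u <= size v -> prefix u v.
Proof.
move=> growth /prefixP[u' eu] /prefixP[v' ev] le_uv.
suff take_uv n : n <= size u -> take n u = take n v.
  by rewrite prefixE -take_uv // take_size.
elim: n => [|n IH] n_u; first by rewrite !take0.
case def_x : u (n_u) => [|x0 w0] // _; rewrite -def_x => {w0 def_x}.
have nthE w w' : q ++ outputs z w = w ++ w' -> n < size w ->
    nth x0 w n = nth x0 (q ++ outputs z (take n w)) n.
  move=> ew n_w; have := growth (take n w); rewrite size_takel; last exact: ltnW.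
  move=> lt_n; transitivity (nth x0 (q ++ outputs z w) n).
    by rewrite ew nth_cat n_w.
  by rewrite -{1}[w](cat_take_drop n) outputs_cat catA nth_cat lt_n.
have n_v := leq_trans n_u le_uv.
rewrite (take_nth x0 n_u) (take_nth x0 n_v) IH; last exact: ltnW.
by rewrite (nthE _ _ eu n_u) (nthE _ _ ev n_v) IH // ltnW.
Qed.

End QueueAutomaton.

(** * Simulation of a Turing machine by a queue automaton *)

Section Simulation.
Variable M : turing_machine.
Local Notation cell := (option (bool + tm_aux M)).

(* None separates successive configurations; Some (x, Some q) is a cell       *)
(* scanned in state q.                                                        *)
Definition symbol : finType := option (cell * option (tm_state M)).

(* Some (inl b) holds back the last symbol b that was read; Some (inr q) has  *)
(* just moved the head right, onto the next symbol; None means halted.        *)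
Definition control : finType := option (symbol + tm_state M).

Definition plain (x : cell) : symbol := Some (x, None).
Definition scanned (q : tm_state M) (x : cell) : symbol := Some (x, Some q).
Definition holding (b : symbol) : control := Some (inl b).
Definition arriving (q : tm_state M) : control := Some (inr q).

Definition sim_step (z : control) (s : symbol) : control :=
  match z with
  | None => None
  | Some (inl b) =>
      if s is Some (x, Some q) then
        match tm_trans q x with
        | None => None
        | Some (_, y, Leftward) => holding (plain y)
        | Some (q', _, Rightward) => arriving q'
        | Some (q', y, Stay) => holding (scanned q' y)
        end
      else holding s
  | Some (inr q) => holding (if s is Some (x, _) then scanned q x else None)
  end.

(** The delay of one symbol lets a left move mark the preceding cell before it is written. A head
    that runs onto a separator, on either side, gets a fresh blank cell. *)
Definition sim_out (z : control) (s : symbol) : seq symbol :=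
  match z with
  | None => [:: s]
  | Some (inl b) =>
      if s is Some (x, Some q) then
        match tm_trans q x with
        | Some (q', _, Leftward) =>
            if b is Some (x', _) then [:: scanned q' x'] else [:: b; scanned q' None]
        | Some (_, y, Rightward) => [:: b; plain y]
        | _ => [:: b]
        end
      else [:: b]
  | Some (inr q) => if s is None then [:: scanned q None] else [::]
  end.

Local Notation srun := (run sim_step).
Local Notation souts := (outputs sim_step sim_out).

Definition lagging (z : control) : nat := if z is Some (inr _) then 0 else 1.

(** A potential argument: each read is paid for by an output or by the symbol held back. *)
Lemma sim_growth z w : size w + lagging z <= size (souts z w) + lagging (srun z w).
Proof.
have growth1 y s : lagging y < size (sim_out y s) + lagging (sim_step y s).
  case: y => [[b|q]|]; last by [].
    rewrite /sim_out /sim_step; case: s => [[x [q|]]|] //=.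
    case: (tm_trans q x) => [[[q' y] []]|] //=.
    by case: b => [[]|].
  by case: s => [[]|].
elim: w z => [|s w IH] z; first by [].
have -> : souts z (s :: w) = sim_out z s ++ souts (sim_step z s) w by [].
apply: leq_trans (_ : size (sim_out z s) + (size w + lagging (sim_step z s)) <= _).
  by rewrite addSn -addnS addnCA leq_add2l.
by rewrite size_cat -addnA leq_add2l.
Qed.

Definition config_word (c : config M) : seq symbol :=
  let: Config q l x r := c in map plain (rev l) ++ scanned q x :: map plain r.

Lemma srun_plain b l : srun (holding b) (map plain l) = holding (last b (map plain l)).
Proof. by elim: l b => //= x l IH b; rewrite -IH. Qed.

Lemma souts_plain b l : souts (holding b) (map plain l) = belast b (map plain l).
Proof. by elim: l b => //= x l IH b; rewrite -IH. Qed.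

Lemma srun_to_separator b l : srun (holding b) (rcons (map plain l) None) = holding None.
Proof. by rewrite -cats1 run_cat srun_plain. Qed.

Lemma souts_to_separator b l :
  souts (holding b) (rcons (map plain l) None) = b :: map plain l.
Proof. by rewrite -cats1 outputs_cat souts_plain srun_plain /= cats1 -lastI. Qed.

(** The held separator is emitted first and the one read last is held in its place, so one pass over
    the queue performs one machine step. *)
Lemma sim_config c c' : tm_step c = Some c' ->
  srun (holding None) (rcons (config_word c) None) = holding None /\
  souts (holding None) (rcons (config_word c) None) = None :: config_word c'.
Proof.
case: c => q l x r; rewrite /tm_step /config_word.
case eq_t: (tm_trans q x) => [[[q' y] d]|] // [<-].
rewrite rcons_cat run_cat outputs_cat srun_plain souts_plain /= eq_t.
case: d {eq_t}.
- rewrite [run _ _ _]srun_to_separator [outputs _ _ _ _]souts_to_separator.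
  split=> //; case: l => [|x' l] //=.
  by rewrite rev_cons map_rcons last_rcons belast_rcons.
- have last_out s : belast None [seq plain i | i <- rev l] ++
      [:: last None [seq plain i | i <- rev l], plain y & s] =
      None :: [seq plain i | i <- rev (y :: l)] ++ s.
    by rewrite rev_cons map_rcons -cat_rcons -lastI /= cat_rcons.
  case: r => [|x' r] /=; first by rewrite last_out.
  rewrite [run _ _ _]srun_to_separator [outputs _ _ _ _]souts_to_separator.
  by rewrite last_out.
- rewrite [run _ _ _]srun_to_separator [outputs _ _ _ _]souts_to_separator.
  by split=> //=; rewrite -cat_rcons -lastI.
Qed.

Lemma sim_halted c : tm_step c = None -> srun (holding None) (config_word c) = None.
Proof.
case: c => q l x r; rewrite /tm_step /config_word.
case eq_t: (tm_trans q x) => [[[q' y] d]|] // _.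
rewrite run_cat srun_plain /= eq_t.
by elim: r.
Qed.

Definition input_word (bits : seq bool) : seq symbol :=
  [seq plain (Some (inl b)) | b <- bits].

Definition initial_queue (bits : seq bool) : seq symbol :=
  rcons (input_word bits) None.

(** Starting as after a right move makes the first symbol read the scanned cell, so the initial
    queue is a letter-by-letter image of the input. *)
Definition sim_start : control := arriving (tm_start M).

Lemma sim_initial bits :
  srun sim_start (initial_queue bits) = holding None /\
  souts sim_start (initial_queue bits) = config_word (tm_init M bits).
Proof.
rewrite /initial_queue /input_word /tm_init /=.
case: bits => [|b bits] //=; rewrite (map_comp plain).
by rewrite [run _ _ _]srun_to_separator [outputs _ _ _ _]souts_to_separator.
Qed.

Lemma sim_config_at bits n c :
  iter n (obind (@tm_step M)) (Some (tm_init M bits)) = Some c ->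
  exists w, [/\ srun sim_start w = holding None, n <= size w &
    initial_queue bits ++ souts sim_start w = w ++ config_word c].
Proof.
elim: n c => [|n IH] c /=.
  move=> [<-]; have [run0 out0] := sim_initial bits.
  by exists (initial_queue bits); split; rewrite ?out0.
case eq_c0: (iter _ _ _) => [c0|] //= c0c.
have [w [run_w size_w out_w]] := IH _ eq_c0.
have [run_c out_c] := sim_config c0c.
exists (w ++ rcons (config_word c0) None); split.
- by rewrite run_cat run_w.
- by rewrite size_cat size_rcons addnS ltnS (leq_trans size_w) ?leq_addr.
- by rewrite outputs_cat run_w out_c catA out_w -!catA cat_rcons.
Qed.

(** One input symbol compensates for the symbol held back, and the final separator makes the
    inequality strict. *)
Lemma initial_queue_growth bits : bits != [::] ->
  forall u, size u < size (initial_queue bits ++ souts sim_start u).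
Proof.
move=> bits0 u; have := sim_growth sim_start u; rewrite addn0 => growth_u.
rewrite size_cat size_rcons addSn ltnS (leq_trans growth_u) // addnC leq_add2r.
rewrite size_map; apply: leq_trans (_ : 1 <= _); last by rewrite lt0n size_eq0.
by case: (srun _ _) => [[]|].
Qed.

Theorem simulation_halts bits : bits != [::] ->
  (exists2 w, consumable sim_step sim_out (initial_queue bits) sim_start w &
     srun sim_start w = None)
  <-> tm_halts M bits.
Proof.
move=> bits0; split=> [[w cons_w run_w]|[n]].
  apply: contrapT => no_halt.
  case eq_c: (iter (size w) (obind (@tm_step M)) (Some (tm_init M bits))) => [c|];
    last by apply: no_halt; exists (size w).
  have [w' [run_w' size_w' out_w']] := sim_config_at eq_c.
  (* A long enough nonhalting history extends [w]; but the halted control is absorbing, while [w']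
     ends in [holding None]. *)
  have /prefixP[u def_w'] : prefix w w'.
    apply: consumable_comparable (initial_queue_growth bits0) cons_w _ size_w'.
    by apply/prefixP; exists (config_word c).
  move: run_w'; rewrite def_w' run_cat run_w.
  by elim: u {def_w'}.
elim: n => //= n IH.
case eq_c: (iter n _ _) => [c|] /=; last by move=> _; exact: IH.
move=> halt_c; have [w [run_w _ out_w]] := sim_config_at eq_c.
exists (w ++ config_word c); last by rewrite run_cat run_w sim_halted.
apply/prefixP; exists (souts (holding None) (config_word c)).
by rewrite outputs_cat run_w catA out_w.
Qed.

End Simulation.

(** * EDT0L systems for histories of a queue automaton *)

Section Nonterminals.
Variables (Z L : finType) (n : nat).

(** [Dead] is never rewritten to a terminal word; it blocks derivations that apply run tables out of
    turn. *)
Inductive nonterminal :=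
| Start | SyncL | SyncR | FreeL | FreeR | Input | Data | Dead
| Phase of 'I_n | Datum of L | Control of Z.

Definition nonterminal_code (m : nonterminal) : ('I_8 + 'I_n) + (L + Z) :=
  match m with
  | Start => inl (inl (@Ordinal 8 0 isT)) | SyncL => inl (inl (@Ordinal 8 1 isT))
  | SyncR => inl (inl (@Ordinal 8 2 isT)) | FreeL => inl (inl (@Ordinal 8 3 isT))
  | FreeR => inl (inl (@Ordinal 8 4 isT)) | Input => inl (inl (@Ordinal 8 5 isT))
  | Data => inl (inl (@Ordinal 8 6 isT)) | Dead => inl (inl (@Ordinal 8 7 isT))
  | Phase i => inl (inr i) | Datum d => inr (inl d) | Control z => inr (inr z)
  end.

Definition nonterminal_decode (c : ('I_8 + 'I_n) + (L + Z)) : nonterminal :=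
  match c with
  | inl (inl i) =>
      nth Dead [:: Start; SyncL; SyncR; FreeL; FreeR; Input; Data] i
  | inl (inr i) => Phase i | inr (inl d) => Datum d | inr (inr z) => Control z
  end.

Lemma nonterminal_codeK : cancel nonterminal_code nonterminal_decode.
Proof. by case. Qed.

HB.instance Definition _ := Finite.copy nonterminal (can_type nonterminal_codeK).

End Nonterminals.
Arguments Start {Z L n}. Arguments SyncL {Z L n}. Arguments SyncR {Z L n}.
Arguments FreeL {Z L n}. Arguments FreeR {Z L n}. Arguments Input {Z L n}.
Arguments Data {Z L n}. Arguments Dead {Z L n}. Arguments Phase {Z L n}.
Arguments Datum {Z L n}. Arguments Control {Z L n}.

Section Rules.
Variables (X : finType) (n : nat).

Inductive rule :=
| StartMismatch | Sync of X | Split of X & X | ExtendL of X | ExtendR of X | Stop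
| StartRun | Interpret of 'I_n | Consume of X.

Definition rule_code (r : rule) : ('I_3 + 'I_n) + (X * X + 'I_4 * X) :=
  match r with
  | StartMismatch => inl (inl (@Ordinal 3 0 isT))
  | Stop => inl (inl (@Ordinal 3 1 isT))
  | StartRun => inl (inl (@Ordinal 3 2 isT))
  | Interpret i => inl (inr i)
  | Split a b => inr (inl (a, b))
  | Sync a => inr (inr (@Ordinal 4 0 isT, a))
  | ExtendL a => inr (inr (@Ordinal 4 1 isT, a))
  | ExtendR a => inr (inr (@Ordinal 4 2 isT, a))
  | Consume a => inr (inr (@Ordinal 4 3 isT, a))
  end.

Definition rule_decode (c : ('I_3 + 'I_n) + (X * X + 'I_4 * X)) : rule :=
  match c with
  | inl (inl i) => nth StartRun [:: StartMismatch; Stop] i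
  | inl (inr i) => Interpret i
  | inr (inl (a, b)) => Split a b
  | inr (inr (i, a)) => nth (Consume a) [:: Sync a; ExtendL a; ExtendR a] i
  end.

Lemma rule_codeK : cancel rule_code rule_decode.
Proof. by case. Qed.

HB.instance Definition _ := Finite.copy rule (can_type rule_codeK).

Definition is_mismatch_rule (r : rule) : bool :=
  match r with
  | StartMismatch | Sync _ | ExtendL _ | ExtendR _ | Stop => true
  | Split a b => a != b
  | _ => false
  end.

Definition is_run_rule (r : rule) : bool :=
  match r with StartRun | Interpret _ | Consume _ => true | _ => false end.

End Rules.
Arguments StartMismatch {X n}. Arguments Sync {X n}. Arguments Split {X n}.
Arguments ExtendL {X n}. Arguments ExtendR {X n}. Arguments Stop {X n}.
Arguments StartRun {X n}. Arguments Interpret {X n}. Arguments Consume {X n}.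

Section HistorySystems.
Variables (X Z L : finType) (n : nat).
Variables (step : Z -> X -> Z) (out : Z -> X -> seq X) (z0 fin : Z).
Variables (interp : nat -> L -> seq X) (queue_end : seq X).
Local Notation nt := (nonterminal Z L n).
Local Notation word := (seq (option X + nt)).
Implicit Types (p u v w g y z : seq X) (data : seq L).

Definition text w : word := [seq inl (Some a) | a <- w].
Definition separator : word := [:: inl None].
Definition nonterm (m : nt) : word := [:: inr m].

(* The phases write the initial queue from left to right: in phase i the      *)
(* letter Data is first expanded into the data word, whose letters are then   *)
(* interpreted by interp i.                                                   *)
Definition phase_word (i : nat) : word :=
  if insub i is Some j then nonterm Data ++ nonterm (Phase j)
  else text queue_end ++ nonterm (Control z0).

(** A table rewrites all nonterminals at once, which synchronises the two sides of the separator: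
    [Consume a] writes [a] on the left and the output for [a] on the right. *)
Definition rule_image (r : rule X n) (m : nt) : word :=
  match r, m with
  | StartMismatch, Start => nonterm SyncL ++ separator ++ nonterm SyncR
  | Sync a, SyncL => text [:: a] ++ nonterm SyncL
  | Sync a, SyncR => text [:: a] ++ nonterm SyncR
  | Split a _, SyncL => text [:: a] ++ nonterm FreeL
  | Split _ b, SyncR => text [:: b] ++ nonterm FreeR
  | ExtendL a, FreeL => text [:: a] ++ nonterm FreeL
  | ExtendR a, FreeR => text [:: a] ++ nonterm FreeR
  | Stop, (FreeL | FreeR | Input) => [::]
  | Stop, Control s => if s == fin then [::] else nonterm Dead
  | Stop, Phase _ => nonterm Dead
  | StartRun, Start => nonterm Input ++ separator ++ phase_word 0
  | Interpret _, Data => nonterm Dead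
  | Interpret i, Phase j => if j == i then phase_word i.+1 else nonterm Dead
  | Interpret i, Datum d => text (interp i d)
  | Consume a, Input => text [:: a] ++ nonterm Input
  | Consume a, Control s => text (out s a) ++ nonterm (Control (step s a))
  | Consume _, Phase _ => nonterm Dead
  | _, _ => nonterm m
  end.

Definition rule_table (r : rule X n) : {ffun nt -> word} := [ffun m => rule_image r m].

Definition data_table data : {ffun nt -> word} :=
  [ffun m => if m is Data then map (fun d => inr (Datum d)) data else nonterm m].

Definition mismatch_tables := [seq rule_table r | r in @is_mismatch_rule X n].
Definition run_tables := [seq rule_table r | r in @is_run_rule X n].
Definition all_tables data := mismatch_tables ++ run_tables ++ [:: data_table data].

Definition queue_prefix data i : seq X :=
  flatten [seq flatten (map (interp j) data) | j <- iota 0 i].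

Definition initial_text data : seq X := queue_prefix data n ++ queue_end.

Local Notation run := (run step).
Local Notation outputs := (outputs step out).

Lemma subst_text (f : {ffun nt -> word}) w : subst f (text w) = text w.
Proof. by rewrite /text (map_comp inl) subst_terminal. Qed.

Lemma subst_separator (f : {ffun nt -> word}) : subst f separator = separator.
Proof. by []. Qed.

Lemma subst_nonterm (f : {ffun nt -> word}) m : subst f (nonterm m) = f m.
Proof. exact: subst1. Qed.

Lemma text_cat u v : text (u ++ v) = text u ++ text v.
Proof. exact: map_cat. Qed.

Lemma Dead_subst (f : {ffun nt -> word}) (w : word) :
  f Dead = nonterm Dead -> inr Dead \in w -> inr Dead \in subst f w.
Proof.
move=> fD; elim: w => //= c w IH; rewrite inE => /predU1P[<-|/IH wD].
  by rewrite /subst /= fD mem_head.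
by rewrite /subst /= mem_cat [X in _ || X]wD orbT.
Qed.

(** The sentential forms reachable by mismatch tables. The flag [e] is shared because [Stop] erases
    [FreeL] and [FreeR] together. *)
Inductive mismatch_form : word -> Prop :=
| MismatchStart : mismatch_form (nonterm Start)
| MismatchSync p :
    mismatch_form (text p ++ nonterm SyncL ++ separator ++ text p ++ nonterm SyncR)
| MismatchFree p a b y z (e : bool) : a != b ->
    mismatch_form (text p ++ text (a :: y) ++ (if e then nonterm FreeL else [::])
      ++ separator
      ++ text p ++ text (b :: z) ++ (if e then nonterm FreeR else [::])).

Inductive run_form data : word -> Prop :=
| RunPhase (i : 'I_n) : run_form data
    (nonterm Input ++ separator ++ text (queue_prefix data i)
     ++ nonterm Data ++ nonterm (Phase i))
| RunData (i : 'I_n) : run_form data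
    (nonterm Input ++ separator ++ text (queue_prefix data i)
     ++ map (fun d => inr (Datum d)) data ++ nonterm (Phase i))
| RunConsume w : run_form data
    (text w ++ nonterm Input ++ separator ++ text (initial_text data)
     ++ text (outputs z0 w) ++ nonterm (Control (run z0 w)))
| RunStop w : run z0 w = fin -> run_form data
    (text w ++ separator ++ text (initial_text data) ++ text (outputs z0 w))
| RunDead (w : word) : inr Dead \in w -> run_form data w.

Lemma run_form_phase data i : i <= n -> run_form data
  (nonterm Input ++ separator ++ text (queue_prefix data i) ++ phase_word i).
Proof.
rewrite /phase_word => le_in; case: insubP => [j _ <-|].
  exact: RunPhase.
rewrite -leqNgt => le_ni; have -> : i = n by apply/eqP; rewrite eqn_leq le_in.
rewrite [X in _ ++ _ ++ X]catA -text_cat.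
exact: (RunConsume data [::]).
Qed.

Lemma subst_data_letters (f : {ffun nt -> word}) (t : L -> word) data :
  (forall d, f (Datum d) = t d) ->
  subst f (map (fun d => inr (Datum d)) data) = flatten (map t data).
Proof. by move=> ft; elim: data => //= d data <-; rewrite /subst /= ft. Qed.

Lemma queue_prefixS data i :
  queue_prefix data i.+1 = queue_prefix data i ++ flatten (map (interp i) data).
Proof. by rewrite /queue_prefix -addn1 iotaD map_cat flatten_cat /= cats0. Qed.

Lemma flatten_text (t : L -> seq X) data :
  flatten [seq text (t d) | d <- data] = text (flatten (map t data)).
Proof. by elim: data => //= d data ->; rewrite text_cat. Qed.

Ltac dead :=
  apply: RunDead; rewrite /nonterm !mem_cat !mem_seq1 /= ?eqxx ?orbT.

Lemma run_form_subst data f (w : word) :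
  f \in all_tables data -> run_form data w -> run_form data (subst f w).
Proof.
rewrite !mem_cat orbA => /orP[fR|]; last first.
  rewrite inE => /eqP-> [i|i|w'|w' run_w'|w' dead_w'].
  - rewrite !subst_cat !subst_nonterm subst_text subst_separator !ffunE.
    exact: RunData.
  - rewrite !subst_cat !subst_nonterm subst_text subst_separator !ffunE.
    rewrite (subst_data_letters (t := fun d => nonterm (Datum d))); last first.
      by move=> d; rewrite ffunE.
    by rewrite [flatten _](flatten_map1 (fun d => inr (Datum d))); exact: RunData.
  - rewrite !subst_cat !subst_nonterm !subst_text subst_separator !ffunE.
    exact: RunConsume.
  - rewrite !subst_cat !subst_text subst_separator.
    exact: RunStop.
  - by apply/RunDead/Dead_subst => //; rewrite ffunE.
have {fR} [r ->] : exists r, f = rule_table r.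
  by case/orP: fR => /mapP[r r_in eq_f]; exists r.
move=> [i|i|w'|w' run_w'|w' dead_w'].
- rewrite !subst_cat !subst_nonterm subst_text subst_separator !ffunE.
  by case: r => *; first [exact: RunPhase | dead].
- rewrite !subst_cat !subst_nonterm subst_text subst_separator !ffunE.
  rewrite (subst_data_letters (t := fun d => rule_image r (Datum d))); last first.
    by move=> d; rewrite ffunE.
  case: r => [|a|a b|a|a|||j|a];
    try by [rewrite [flatten _](flatten_map1 (fun d => inr (Datum d))); exact: RunData
           | dead].
  case: (eqVneq i j) => [<-|neq_ij].
    rewrite [rule_image _ (Phase _)]/= eqxx flatten_text.
    by have := run_form_phase data (ltn_ord i); rewrite queue_prefixS text_cat -!catA.
  by rewrite [rule_image _ (Phase _)]/= (negPf neq_ij); dead.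
- rewrite !subst_cat !subst_nonterm !subst_text subst_separator !ffunE.
  case: r => [|a|a b|a|a|||j|a]; try exact: RunConsume.
  + rewrite [rule_image _ (Control _)]/=; case: eqP => [run_w'|_]; last by dead.
    by rewrite cats0; exact: RunStop.
  + have := RunConsume data (w' ++ [:: a]).
    by rewrite outputs_cat run_cat /= cats0 !text_cat -!catA.
- rewrite !subst_cat !subst_text subst_separator.
  exact: RunStop.
- by apply/RunDead/Dead_subst => //; rewrite ffunE; case: r.
Qed.

Lemma mismatch_form_subst f (w : word) :
  f \in mismatch_tables -> mismatch_form w -> mismatch_form (subst f w).
Proof.
move=> /mapP[r rM ->] [|p|p a b y z e neq_ab].
- rewrite subst_nonterm ffunE.
  case: r rM; try (move=> *; exact: MismatchStart); last by rewrite mem_enum.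
  by move=> _; exact: (MismatchSync [::]).
- rewrite !subst_cat !subst_nonterm !subst_text subst_separator !ffunE.
  case: r rM => [|c|c d|c|c|||j|c] rM; try exact: MismatchSync.
    by have := MismatchSync (p ++ [:: c]); rewrite !text_cat -!catA.
  by move: rM; rewrite mem_enum => neq_cd; exact: (MismatchFree p [::] [::] true neq_cd).
- rewrite !subst_cat !subst_text subst_separator.
  case: e; last by exact: (MismatchFree _ _ _ false).
  rewrite !subst_nonterm !ffunE.
  case: r rM => [|c|c d|c|c|||j|c] rM; try exact: (MismatchFree _ _ _ true).
  + have := MismatchFree p (y ++ [:: c]) z true neq_ab.
    by rewrite -!cat_cons !text_cat -!catA.
  + have := MismatchFree p y (z ++ [:: c]) true neq_ab.
    by rewrite -!cat_cons !text_cat -!catA.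
  + exact: (MismatchFree _ _ _ false).
Qed.

Definition mismatched w g :=
  exists p a b y z, [/\ a != b, w = p ++ a :: y & g = p ++ b :: z].

Definition history w g : seq (option X) := map Some w ++ None :: map Some g.

Lemma history_inj w g w' g' : history w g = history w' g' -> w = w' /\ g = g'.
Proof.
have some_inj : injective (map (@Some X)) by apply: inj_map => ? ? [].
by elim: w w' => [|a w IH] [|a' w'] //= [] => [/some_inj ->|-> /IH[-> ->]].
Qed.

(** The length bound excludes that [g] is a proper prefix of [w], where no position differs. *)
Lemma mismatchedP w g : size w <= size g -> mismatched w g <-> ~~ prefix w g.
Proof.
move=> le_wg; split=> [[p [a [b [y [z [neq_ab -> ->]]]]]]|].
  by rewrite prefix_catr //= eqxx (negPf neq_ab).
elim: w g le_wg => [|a w IH] [|b g] //= le_wg.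
case: (eqVneq a b) => [->|neq_ab _]; last by exists [::], a, b, w, g.
by move=> /(IH _ le_wg)[p [a' [b' [y [z [? -> ->]]]]]]; exists (b :: p), a', b', y, z.
Qed.

Lemma history_text w g : map inl (history w g) = text w ++ separator ++ text g.
Proof. by rewrite /history map_cat /= -!map_comp. Qed.

Local Notation Fm := mismatch_tables.

Lemma mismatch_table_in (r : rule X n) : is_mismatch_rule r -> rule_table r \in Fm.
Proof. by move=> r_m; apply/mapP; exists r; rewrite ?mem_enum. Qed.

Lemma run_table_in (r : rule X n) : is_run_rule r -> rule_table r \in run_tables.
Proof. by move=> r_m; apply/mapP; exists r; rewrite ?mem_enum. Qed.

Lemma rule_derives (r : rule X n) (u : word) :
  is_mismatch_rule r -> derives Fm u (subst (rule_table r) u).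
Proof. by move=> r_m; exact/derives1/mismatch_table_in. Qed.

Lemma derives_iter (F : seq {ffun nt -> word}) (r : X -> rule X n) (h : seq X -> word) :
  (forall c, rule_table (r c) \in F) ->
  (forall u c, subst (rule_table (r c)) (h u) = h (u ++ [:: c])) ->
  forall u, derives F (h [::]) (h u).
Proof.
move=> rF hE; elim/last_ind => [|u c IH]; first exact: derives_refl.
by rewrite -cats1 -hE; exact: derives_subst.
Qed.

Lemma mismatch_complete w g :
  mismatched w g -> derives Fm (nonterm Start) (map inl (history w g)).
Proof.
move=> [p [a [b [y [z [neq_ab -> ->]]]]]].
apply: derives_trans (rule_derives (r := StartMismatch) _ isT) _.
rewrite subst_nonterm ffunE.
apply: derives_trans (derives_iter (r := Sync)
    (h := fun u => text u ++ nonterm SyncL ++ separator ++ text u ++ nonterm SyncR)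
    (F := Fm) _ _ p) _.
- by move=> c; exact: mismatch_table_in.
- move=> u c; rewrite !subst_cat !subst_nonterm !subst_text subst_separator !ffunE.
  by rewrite !text_cat -!catA.
apply: derives_trans (rule_derives (r := Split a b) _ neq_ab) _.
rewrite !subst_cat !subst_nonterm !subst_text subst_separator !ffunE.
apply: derives_trans (derives_iter (r := ExtendL)
    (h := fun u => text p ++ text (a :: u) ++ nonterm FreeL ++ separator
                   ++ text p ++ text [:: b] ++ nonterm FreeR)
    (F := Fm) _ _ y) _.
- by move=> c; exact: mismatch_table_in.
- move=> u c; rewrite !subst_cat !subst_nonterm !subst_text subst_separator !ffunE.
  by rewrite -cat_cons !text_cat -!catA.
apply: derives_trans (derives_iter (r := ExtendR)
    (h := fun u => text p ++ text (a :: y) ++ nonterm FreeL ++ separator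
                   ++ text p ++ text (b :: u) ++ nonterm FreeR)
    (F := Fm) _ _ z) _.
- by move=> c; exact: mismatch_table_in.
- move=> u c; rewrite !subst_cat !subst_nonterm !subst_text subst_separator !ffunE.
  by rewrite -!cat_cons !text_cat -!catA.
have := rule_derives (r := Stop)
  (text p ++ text (a :: y) ++ nonterm FreeL ++ separator
    ++ text p ++ text (b :: z) ++ nonterm FreeR) isT.
rewrite !subst_cat !subst_nonterm !subst_text subst_separator !ffunE.
by rewrite history_text !text_cat /= cats0 -!catA.
Qed.

Lemma derives_mismatch_form (w : word) : derives Fm (nonterm Start) w -> mismatch_form w.
Proof. by elim=> [|f w' fF _]; [exact: MismatchStart|exact: mismatch_form_subst]. Qed.

Lemma mismatch_sound (v : seq (option X)) :
  derives Fm (nonterm Start) (map inl v) -> exists w g, v = history w g /\ mismatched w g.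
Proof.
have term_inj : injective (map (@inl (option X) nt)) by apply: inj_map => ? ? [].
move=> /derives_mismatch_form; move def_w: (map inl v) => w mw; case: mw def_w.
- by case: v.
- move=> p /(congr1 (fun w : word => inr SyncL \in w)).
  by rewrite !mem_cat mem_head orbT; case/mapP.
move=> p a b y z [] neq_ab def_v.
  move: def_v => /(congr1 (fun w : word => inr FreeL \in w)).
  by rewrite !mem_cat mem_head !orbT; case/mapP.
exists (p ++ a :: y), (p ++ b :: z); split; last by exists p, a, b, y, z.
by apply: term_inj; rewrite def_v history_text !text_cat /= cats0 -!catA.
Qed.

(** [Start] is the only nonterminal of a mismatch form that these tables can change, so the two
    kinds of derivation do not mix. *)
Lemma mismatch_form_run data f (w : word) :
  f \in run_tables ++ [:: data_table data] -> mismatch_form w ->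
  subst f w = w \/ run_form data (subst f w).
Proof.
have fixed (f' : {ffun nt -> word}) : f' SyncL = nonterm SyncL ->
    f' SyncR = nonterm SyncR -> f' FreeL = nonterm FreeL ->
    f' FreeR = nonterm FreeR ->
    f' Start = nonterm Start \/ run_form data (f' Start) -> mismatch_form w ->
    subst f' w = w \/ run_form data (subst f' w).
  move=> fSL fSR fFL fFR fS [|p|p a b y z e _]; first by rewrite subst_nonterm.
    by left; rewrite !subst_cat !subst_nonterm !subst_text subst_separator fSL fSR.
  left; rewrite !subst_cat !subst_text subst_separator.
  by case: e; rewrite ?subst_nonterm ?fFL ?fFR.
rewrite mem_cat => /orP[/mapP[r + ->]|].
  rewrite mem_enum => r_run; apply: fixed; rewrite ffunE; try by case: r r_run.
  case: r r_run => //=; try by left.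
  by right; exact: (run_form_phase data (leq0n n)).
by rewrite inE => /eqP->; apply: fixed; rewrite ffunE; try by left.
Qed.

Lemma all_tables_derives data (v : seq (option X)) :
  derives (all_tables data) (nonterm Start) (map inl v) ->
  derives Fm (nonterm Start) (map inl v) \/
  exists2 w, run z0 w = fin & v = history w (initial_text data ++ outputs z0 w).
Proof.
have form (w : word) : derives (all_tables data) (nonterm Start) w ->
    derives Fm (nonterm Start) w \/ run_form data w.
  elim=> [|f w' fF _ [mw|rw]]; first by left; exact: derives_refl.
  - move: fF; rewrite mem_cat => /orP[fF|fR]; first by left; exact: derives_subst.
    by case: (mismatch_form_run fR (derives_mismatch_form mw)) => [->|]; [left|right].
  - by right; exact: run_form_subst.
have term_inj : injective (map (@inl (option X) nt)) by apply: inj_map => ? ? [].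
move=> /form [] // rw; first by left.
move def_w: (map inl v) rw => w rw; right; case: rw def_w.
- move=> i /(congr1 (fun w : word => inr Input \in w)).
  by rewrite !mem_cat mem_head; case/mapP.
- move=> i /(congr1 (fun w : word => inr Input \in w)).
  by rewrite !mem_cat mem_head; case/mapP.
- move=> w' /(congr1 (fun w : word => inr Input \in w)).
  by rewrite !mem_cat mem_head orbT; case/mapP.
- move=> w' fin_w' def_v; exists w' => //.
  by apply: term_inj; rewrite def_v history_text text_cat.
- by move=> w' + def_v; rewrite -def_v => /mapP[].
Qed.

Lemma run_complete data w : run z0 w = fin ->
  derives (all_tables data) (nonterm Start)
    (map inl (history w (initial_text data ++ outputs z0 w))).
Proof.
move=> fin_w; rewrite history_text text_cat.
have mem_rule (r : rule X n) : is_run_rule r || is_mismatch_rule r ->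
    rule_table r \in all_tables data.
  rewrite !mem_cat => /orP[r_run|r_mis].
    by rewrite run_table_in ?orbT.
  by rewrite mismatch_table_in.
apply: derives_trans (derives1 _ (mem_rule StartRun isT)) _.
rewrite subst_nonterm ffunE /=.
have phases i : i <= n -> derives (all_tables data)
    (nonterm Input ++ separator ++ phase_word 0)
    (nonterm Input ++ separator ++ text (queue_prefix data i) ++ phase_word i).
  elim: i => [|i IH] lt_in; first exact: derives_refl.
  apply: derives_trans (IH (ltnW lt_in)) _.
  rewrite {1}/phase_word insubT.
  have data_in : data_table data \in all_tables data by rewrite !mem_cat mem_head !orbT.
  apply: derives_trans (derives1 _ data_in) _.
  rewrite !subst_cat !subst_nonterm !subst_text subst_separator !ffunE.
  have := derives1 (nonterm Input ++ separator ++ text (queue_prefix data i)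
     ++ map (fun d => inr (Datum d)) data ++ nonterm (Phase (Ordinal lt_in)))
     (mem_rule (Interpret (Ordinal lt_in)) isT).
  rewrite !subst_cat !subst_nonterm !subst_text subst_separator !ffunE.
  rewrite (subst_data_letters
    (t := fun d => rule_image (Interpret (Ordinal lt_in)) (Datum d))); last first.
    by move=> d; rewrite ffunE.
  rewrite flatten_text [rule_image _ (Phase _)]/= eqxx.
  by rewrite queue_prefixS text_cat -!catA.
apply: derives_trans (phases n (leqnn n)) _.
have -> : phase_word n = text queue_end ++ nonterm (Control z0).
  by rewrite /phase_word insubF ?ltnn.
rewrite [text (queue_prefix data n) ++ _]catA -text_cat -/(initial_text data).
apply: derives_trans (derives_iter (r := Consume)
  (h := fun u => text u ++ nonterm Input ++ separator ++ text (initial_text data)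
     ++ text (outputs z0 u) ++ nonterm (Control (run z0 u)))
  (F := all_tables data) _ _ w) _.
- by move=> c; apply: mem_rule.
- move=> u c; rewrite !subst_cat !subst_nonterm !subst_text subst_separator !ffunE.
  by rewrite outputs_cat run_cat /= cats0 !text_cat -!catA.
have := derives1 (text w ++ nonterm Input ++ separator ++ text (initial_text data)
     ++ text (outputs z0 w) ++ nonterm (Control (run z0 w))) (mem_rule Stop isT).
rewrite !subst_cat !subst_nonterm !subst_text subst_separator !ffunE.
by rewrite /= fin_w eqxx cats0.
Qed.

End HistorySystems.

(** * Self-reference *)

Section EnumSplit.
Variable T : finType.

Lemma enum_split2 (x y : T) : x != y -> exists u v w,
  enum T = u ++ x :: v ++ y :: w \/ enum T = u ++ y :: v ++ x :: w.
Proof.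
move=> neq_xy.
have split_at z (s : seq T) : z \in s -> exists s1 s2, s = s1 ++ z :: s2.
  by case/path.splitPr=> s1 s2; exists s1, s2.
have [s1 [s2 def_enum]] := split_at x _ (mem_enum T x).
have : y \in enum T by rewrite mem_enum.
rewrite def_enum mem_cat inE eq_sym (negPf neq_xy) /= => /orP[] /split_at[s3 [s4 ->]].
  by exists s3, s4, s2; right; rewrite -catA.
by exists s1, s3, s4; left.
Qed.

End EnumSplit.

Section DataCode.
Variables (X Z L : finType) (n : nat).
Local Notation nt := (nonterminal Z L n).
Local Notation em := (@symbol_letter (option X) nt).
Local Notation symb :=
  (letter 'I_#|{: option (option (option X))}| + 'I_#|{: letter nt}|)%type.

Definition datum_letter (t : bool) (d : L) := em t (inr (Datum d)).

Definition data_code (t : bool) (data : seq L) : seq nat :=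
  map (@symbol_code _ _) (signed datum_letter t data).

(** Only the images of [Data] and its formal inverse depend on [data]. The sign [s] records which of
    the two is enumerated first. *)
Lemma data_table_code : exists s u v w, forall data,
  endo_code (endo (@data_table X Z L n data)) =
  u ++ data_code s data ++ v ++ data_code (~~ s) data ++ w.
Proof.
pose y t := em t (inr Data).
pose c data x := word_code (endo (@data_table X Z L n data) x).
have cy data t : c data (y t) = rcons (data_code t data) 0.
  rewrite /c /word_code /y /endo ffunE /= enum_rankK ffunE; congr (rcons (map _ _) _).
  by rewrite -[RHS]map_id; apply: signed_map.
have cx data x : (forall t, x != y t) -> c data x = c [::] x.
  move=> neq_x; rewrite /c /endo !ffunE; case: x neq_x => // j neq_j.
  rewrite !ffunE; case def_m: (enum_val j).1 => //.
  case/eqP: (neq_j (enum_val j).2); rewrite /y /symbol_letter -def_m.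
  by rewrite -surjective_pairing enum_valK.
have cs data (l : seq _) : (forall t, y t \notin l) ->
    flatten (map (c data) l) = flatten (map (c [::]) l).
  move=> notin_l; congr flatten; apply/eq_in_map => x xl; apply: cx => t.
  by apply: contraNneq (notin_l t) => <-.
have neq_y : y true != y false.
  by apply/eqP => -[] /enum_rank_inj.
have [u [v [w def_enum]]] := enum_split2 neq_y.
have {def_enum}[s def_enum] : exists s, enum {: symb}
    = u ++ y s :: v ++ y (~~ s) :: w.
  by case: def_enum => ->; [exists true|exists false].
have notin t : [/\ y t \notin u, y t \notin v & y t \notin w].
  have : count_mem (y t) (enum {: symb}) = 1.
    by rewrite count_uniq_mem ?enum_uniq // mem_enum.
  rewrite def_enum count_cat /= count_cat /= => count1.
  have yt : (y s == y t) || (y (~~ s) == y t).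
    by case: t s {def_enum count1} => [] []; rewrite eqxx ?orbT.
  have {count1 yt} :
    [/\ count_mem (y t) u = 0, count_mem (y t) v = 0 & count_mem (y t) w = 0].
    move: (count_mem _ u) (count_mem _ v) (count_mem _ w) yt count1 => cu cv cw.
    by case: eqP => _; case: eqP => _ // _ /= count1; split; lia.
  by case=> /count_memPn u0 /count_memPn v0 /count_memPn w0.
exists s, (flatten (map (c [::]) u)), (0 :: flatten (map (c [::]) v)),
  (0 :: flatten (map (c [::]) w)) => data.
have -> : endo_code (endo (@data_table X Z L n data)) =
    flatten (map (c data) (enum {: symb})).
  by [].
rewrite def_enum map_cat flatten_cat /= map_cat flatten_cat /= !cy !cat_rcons.
by rewrite !cs // => t; case: (notin t).
Qed.

End DataCode.

Section SelfReference.

Definition segmented : finType := ('I_3 * bool * bool)%type.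
Implicit Types (d : segmented) (data : seq segmented) (pre mid post : seq bool).

Definition mirror d : segmented := (d.1, ~~ d.2).

Definition segment (i : 'I_3) (bs : seq bool) : seq segmented :=
  [seq (i, b, false) | b <- bs].

(** Mirrored letters carry no literal bits, so the second half of a palindromic data word is silent
    in literal phases. *)
Definition segment_bits (i : nat) d : seq bool :=
  if (d.1.1 == i :> nat) && ~~ d.2 then [:: d.1.2] else [::].

Variable quote : bool -> segmented -> seq bool.

Definition phase_bits (s : bool) (i : nat) d : seq bool :=
  if odd i then quote (if i == 1 then s else ~~ s) d else segment_bits i./2 d.

(* The code of a table contains both the data word and its inverse, whence    *)
(* two quotations. Data words are mirror-palindromes, which allows the        *)
(* quotation of the reversed word to be read off from left to right.          *)
Lemma self_reference s pre mid post : exists data,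
  rev data = map mirror data /\
  flatten [seq flatten (map (phase_bits s i) data) | i <- iota 0 5] =
  pre ++ flatten (map (quote s) data) ++ mid ++ flatten (map (quote (~~ s)) data) ++ post.
Proof.
pose y := segment (@Ordinal 3 0 isT) pre ++ segment (@Ordinal 3 1 isT) mid
  ++ segment (@Ordinal 3 2 isT) post.
have mirrorK : involutive mirror by move=> [[i b] m]; rewrite /mirror /= negbK.
exists (y ++ rev (map mirror y)); split.
  by rewrite rev_cat revK map_cat map_rev -map_comp (eq_map mirrorK) map_id.
have segE i j bs : flatten (map (segment_bits i) (segment j bs)) =
    if (j == i :> nat) then bs else [::].
  rewrite /segment /segment_bits; elim: bs => [|b bs IH] /=; first by rewrite if_same.
  by rewrite IH /=; case: (_ == _).
have mirE i bs : all (fun d => ~~ d.2) bs ->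
    flatten (map (segment_bits i) (rev (map mirror bs))) = [::].
  rewrite map_rev; elim: bs => //= d bs IH /andP[d2 /IH].
  rewrite rev_cons -cats1 flatten_cat => ->.
  by rewrite /segment_bits /= d2 andbF.
have all_y : all (fun d => ~~ d.2) y.
  by rewrite !all_cat; apply/and3P; split; rewrite /segment all_map; apply/allP.
set data := y ++ _.
have segP i : flatten (map (segment_bits i) data) =
    if i == 0 then pre else if i == 1 then mid else if i == 2 then post else [::].
  rewrite map_cat flatten_cat (mirE _ _ all_y) cats0 !map_cat !flatten_cat !segE /=.
  by case: i => [|[|[|i]]] /=; rewrite ?cats0.
(* Phases 0, 2 and 4 write the literal segments, phases 1 and 3 the two quotations. *)
transitivity (flatten (map (segment_bits 0) data) ++ flatten (map (quote s) data)
  ++ flatten (map (segment_bits 1) data) ++ flatten (map (quote (~~ s)) data)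
  ++ flatten (map (segment_bits 2) data) ++ [::]); first by [].
by rewrite !segP cats0.
Qed.

End SelfReference.

(** * The self-referential pair of presentations *)

Section Diagonal.
Variable M : turing_machine.
Local Notation X := (symbol M).
Local Notation Z := (control M).
Local Notation nt := (nonterminal Z segmented 5).

(** The inverted copy lists the data backwards, which for palindromic data amounts to mirroring each
    letter. The quotation depends on the alphabets but not on the rules, so using it inside the
    rules is not circular. *)
Definition quoted_datum (t : bool) (d : segmented) : seq bool :=
  nat_code (symbol_code (@datum_letter X Z segmented 5 t (if t then mirror d else d))).

Section Presentations.
Variable s : bool.

Definition phase_symbols (i : nat) (d : segmented) : seq X :=
  input_word M (phase_bits quoted_datum s i d).

Definition mismatch_part :=
  mismatch_tables 5 (@sim_step M) (@sim_out M) (sim_start M) None phase_symbols [:: None].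

Definition whole data :=
  all_tables 5 (@sim_step M) (@sim_out M) (sim_start M) None phase_symbols [:: None] data.

End Presentations.

Definition mismatch_presentation s := presentation_of Start (mismatch_part s).
Definition whole_presentation s data := presentation_of Start (whole s data).

Lemma bits_of_nats_cat (u v : seq nat) :
  flatten (map nat_code (u ++ v)) = flatten (map nat_code u) ++ flatten (map nat_code v).
Proof. by rewrite map_cat flatten_cat. Qed.

(** The data table comes last and the header counts do not depend on [data], so everything outside
    its two copies is constant. *)
Lemma pair_code_data : exists s pre mid post, forall data,
  pair_code (mismatch_presentation s, whole_presentation s data) =
  pre ++ flatten (map nat_code (@data_code X Z segmented 5 s data)) ++ mid
  ++ flatten (map nat_code (@data_code X Z segmented 5 (~~ s) data)) ++ post.
Proof.
have [s [u [v [w codeE]]]] := data_table_code X Z segmented 5.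
pose axiom := edt0l_axiom (ep_relators (whole_presentation s [::])).
pose part := mismatch_part s ++
  run_tables 5 (@sim_step M) (@sim_out M) (sim_start M) None (phase_symbols s) [:: None].
pose before := [:: #|{: option (option (option X))}|; #|{: letter nt}|; (size part).+1]
  ++ word_code axiom ++ flatten [seq endo_code (endo f) | f <- part].
have natsE data : presentation_nats (whole_presentation s data) =
    before ++ endo_code (endo (@data_table X Z segmented 5 data)).
  have -> : presentation_nats (whole_presentation s data) =
      [:: #|{: option (option (option X))}|; #|{: letter nt}|;
          size (map (@endo _ _) (whole s data))]
      ++ word_code axiom
      ++ flatten [seq endo_code phi | phi <- map (@endo _ _) (whole s data)].
    by [].
  have -> : whole s data = part ++ [:: @data_table X Z segmented 5 data].
    by rewrite /whole /all_tables catA.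
  rewrite size_map size_cat addn1 -map_comp map_cat flatten_cat /= cats0.
  by [].
exists s, (presentation_code (mismatch_presentation s)
  ++ flatten (map nat_code (before ++ u))).
exists (flatten (map nat_code v)), (flatten (map nat_code w)) => data.
have -> : pair_code (mismatch_presentation s, whole_presentation s data) =
    presentation_code (mismatch_presentation s)
    ++ flatten (map nat_code (presentation_nats (whole_presentation s data))) by [].
by rewrite natsE codeE !bits_of_nats_cat -!catA.
Qed.

Lemma quoted_data t data : rev data = map mirror data ->
  flatten (map nat_code (@data_code X Z segmented 5 t data)) =
  flatten (map (quoted_datum t) data).
Proof.
rewrite /data_code /signed /quoted_datum => rev_data.
by case: t; rewrite -?map_rev ?rev_data -!map_comp.
Qed.

Lemma input_word_flatten (ss : seq (seq bool)) :
  input_word M (flatten ss) = flatten (map (input_word M) ss).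
Proof. exact: map_flatten. Qed.

Lemma self_referential_pair : exists s data,
  let bits := pair_code (mismatch_presentation s, whole_presentation s data) in
  initial_text 5 (phase_symbols s) [:: None] data = initial_queue M bits.
Proof.
have [s [pre [mid [post codeE]]]] := pair_code_data.
have [data [rev_data phasesE]] := self_reference quoted_datum s pre mid post.
exists s, data; rewrite codeE !quoted_data // -phasesE.
rewrite /initial_queue -cats1 /initial_text; congr (_ ++ _).
rewrite input_word_flatten -map_comp; congr flatten.
by apply: eq_map => i /=; rewrite input_word_flatten -map_comp.
Qed.

Lemma marked_iso_iff_diverges : exists P Q,
  marked_iso (ep_marked_group P) (ep_marked_group Q) <-> ~ tm_halts M (pair_code (P, Q)).
Proof.
have [s [data]] := self_referential_pair.
set P := mismatch_presentation s; set Q := whole_presentation s data.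
move=> /= queueE; exists P, Q; set bits := pair_code (P, Q) in queueE *.
have bits0 : bits != [::].
  rewrite -size_eq0 size_cat addn_eq0 negb_and; apply/orP; left.
  by rewrite /presentation_code /= size_cat size_rcons.
rewrite system_marked_iso; last by move=> f; rewrite mem_cat => ->.
rewrite -(simulation_halts M bits0); split=> [whole_part [w cons_w fin_w]|no_halt v].
  have /whole_part/mismatch_sound[w' [g' [/history_inj[<- <-]]]] :=
    run_complete 5 (@sim_out M) (phase_symbols s) [:: None] data fin_w.
  rewrite queueE => /mismatchedP; rewrite /consumable in cons_w.
  by rewrite cons_w => /(_ (size_prefix cons_w)).
move=> /all_tables_derives[//|[w fin_w ->]].
apply: mismatch_complete; rewrite queueE; apply/mismatchedP.
  (* Growth supplies the length bound under which not being a prefix means differing at some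
     position. *)
  by apply: ltnW; exact: initial_queue_growth.
by apply/negP => cons_w; apply: no_halt; exists w.
Qed.

End Diagonal.

Theorem proposition2 :
  ~ semi_decidable pair_code
      (fun PQ : edt0l_presentation * edt0l_presentation =>
         marked_iso (ep_marked_group PQ.1) (ep_marked_group PQ.2)).
Proof.
move=> [M halts_iff_iso].
have [P [Q iso_iff]] := marked_iso_iff_diverges M.
have := halts_iff_iso (P, Q); rewrite /= iso_iff => halt_iff.
have no_halt : ~ tm_halts M (pair_code (P, Q)).
  by move=> halt; exact: (proj1 halt_iff halt halt).
exact/no_halt/(proj2 halt_iff no_halt).
Qed.
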